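(* Let $X=X(\mathbb N)$ be a separable rearrangement invariant space on $\mathbb N$, with Boyd indices $p_X$ and $q_X$, and let $1<p,q<\infty$. (1) If $X(\mathbb N)$ has the $UDS_p$-property, then $p\le p_X$. (2) If $X(\mathbb N)$ has the $UDT_q$-property, then $q\ge q_X$.
   Context: Rearrangement invariant (r.i.) spaces are real and understood in the sense of Lindenstrauss–Tzafriri, Classical Banach Spaces II. A separable r.i. space on $\mathbb N$ is, with its natural order, a Banach lattice of sequences whose norm is invariant under permutations of $\mathbb N$ (the norm depends only on the decreasing rearrangement of $|x|$); the unit vectors $e_n=\chi_{\{n\}}$ form a symmetric basis of it. Estimates: a sequence $\{x_k\}_{k=1}^\infty$ in a Banach space has an upper $p$-estimate (resp. a lower $q$-estimate) with constant $C>0$ if for all $n\in\mathbb N$ and $a_1,\dots,a_n\in\mathbb R$, $\|\sum_{k=1}^n a_kx_k\|\le C(\sum_{k=1}^n|a_k|^p)^{1/p}$ (resp. $C(\sum_{k=1}^n|a_k|^q)^{1/q}\le\|\sum_{k=1}^n a_kx_k\|$). A Banach lattice $X$ has the $UDS_p$-property (resp. $UDT_q$-property) if there is a constant $C>0$ such that every normalized disjoint sequence in $X$ (norm-one, pairwise disjoint vectors) has a subsequence with an upper $p$-estimate (resp. a lower $q$-estimate) with constant $C$. Boyd indices: for $f=(a_1,a_2,\dots)$ and $n\in\mathbb N$ let $D_nf=(a_1,\dots,a_1,a_2,\dots,a_2,\dots)$ (each entry repeated $n$ times) and $D_{1/n}f=n^{-1}\left(\sum_{i=1}^n a_i,\sum_{i=n+1}^{2n}a_i,\dots\right)$,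 regarded as operators on $X(\mathbb N)$. Then $p_X=\lim_{n\to\infty}\frac{\log n}{\log\|D_n\|}$ and $q_X=\lim_{n\to\infty}\frac{\log(1/n)}{\log\|D_{1/n}\|}$, with the usual convention that the index is $\infty$ if the norms in the denominator equal $1$. *)

(* Defs.v *)
From HB Require Import structures.
From mathcomp Require Import all_boot all_order all_algebra.
From mathcomp Require Import all_classical all_reals all_analysis.

Set Implicit Arguments.
Unset Strict Implicit.
Unset Printing Implicit Defensive.

Import Order.TTheory GRing.Theory Num.Theory.
Import numFieldNormedType.Exports.

Local Open Scope classical_set_scope.
Local Open Scope ring_scope.

Definition separable (T : topologicalType) : Prop :=
  exists S : set T, countable S /\ dense S.

Section Estimates.
Variables (R : realType) (E : normedModType R).

Definition upper_estimate (p C : R) (x : nat -> E) : Prop :=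
  forall (n : nat) (a : nat -> R),
    `|\sum_(k < n) a k *: x k| <= C * (\sum_(k < n) `|a k| `^ p) `^ p^-1.

Definition lower_estimate (q C : R) (x : nat -> E) : Prop :=
  forall (n : nat) (a : nat -> R),
    C * (\sum_(k < n) `|a k| `^ q) `^ q^-1 <= `|\sum_(k < n) a k *: x k|.

End Estimates.

(* [D_n f] and [D_{1/n} f], with sequences indexed from 0. *)
Definition dilate (R : realType) (n : nat) (f : nat -> R) : nat -> R :=
  fun k => f (k %/ n)%N.

Definition compress (R : realType) (n : nat) (f : nat -> R) : nat -> R :=
  fun k => n%:R^-1 * \sum_(i < n) f (k * n + i)%N.

(* The norm of the Koethe dual: [associate rho] of the (extended) norm of X is
   finite exactly on X', where it is the norm inherited from X^*. *)
Definition associate (R : realType) (rho : (nat -> R) -> \bar R) :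
    (nat -> R) -> \bar R :=
  fun g => ereal_sup [set (\sum_(0 <= k <oo) `|f k * g k|%:E)%E
                     | f in [set f : nat -> R | (rho f <= 1)%E]].

(* A Banach space of real sequences is given as a complete normed space X
   together with an injective linear map [coord] sending a vector to its
   sequence of entries; the order of X is the entrywise one. *)
Section SequenceSpace.
Variables (R : realType) (X : completeNormedModType R).
Variable coord : {linear X -> (nat -> R^o)}.

(* The norm of X on all sequences: +oo off X (the infimum is over at most one
   vector when [coord] is injective). *)
Definition seq_norm (f : nat -> R) : \bar R :=
  ereal_inf [set `|x|%:E | x in [set x : X | coord x = f]].

(* Rearrangement invariant space on N in the sense of Lindenstrauss-Tzafriri,
   Definition II.2.a.1. *)
Record ri_space : Prop := RISpace {
  ri_inj : injective coord;
  (* Koethe function space *)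
  ri_ideal : forall f g : nat -> R,
    (forall k, `|f k| <= `|g k|) -> (seq_norm f <= seq_norm g)%E;
  ri_indic : forall A : set nat, finite_set A -> (seq_norm \1_A < +oo)%E;
  (* (i) the automorphisms of N are the permutations of N *)
  ri_invariant : forall (tau : nat -> nat) (f : nat -> R),
    bijective tau -> seq_norm (f \o tau) = seq_norm f;
  (* (ii) X' is norming, and X is maximal or minimal *)
  ri_norming : forall x : X,
    associate (associate seq_norm) (coord x) = `|x|%:E;
  ri_max_or_min :
    (forall f : nat -> R, (associate (associate seq_norm) f < +oo)%E ->
       exists x : X, coord x = f)
    \/ dense [set x : X | finite_set [set k | coord x k != 0]];
  (* (iii) l_1 is in X and X in l_oo, with inclusions of norm one *)
  ri_l1 : forall f : nat -> R,
    (seq_norm f <= \sum_(0 <= k <oo) `|f k|%:E)%E;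
  ri_linfty : forall (x : X) (k : nat), `|coord x k| <= `|x|
}.

Definition disjoint_vec (x y : X) : Prop :=
  forall k, Num.min `|coord x k| `|coord y k| = 0.

Definition normalized_disjoint (x : nat -> X) : Prop :=
  (forall k, `|x k| = 1) /\ (forall i j, i <> j -> disjoint_vec (x i) (x j)).

Definition UDS (p : R) : Prop :=
  exists2 C : R, 0 < C & forall x : nat -> X, normalized_disjoint x ->
    exists2 phi : nat -> nat, increasing_seq phi
      & upper_estimate p C (x \o phi).

Definition UDT (q : R) : Prop :=
  exists2 C : R, 0 < C & forall x : nat -> X, normalized_disjoint x ->
    exists2 phi : nat -> nat, increasing_seq phi
      & lower_estimate q C (x \o phi).

Definition op_norm (T : (nat -> R) -> (nat -> R)) : \bar R :=
  ereal_sup [set seq_norm (T (coord x)) | x in [set x : X | `|x| <= 1]].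

(* Quotient [ln t / ln N], with the convention that it is +oo when N = 1. The
   norms N used below are finite on an r.i. space, so [fine] loses nothing. *)
Definition index_quotient (t : R) (N : \bar R) : \bar R :=
  if N == 1%E then +oo%E else (ln t / ln (fine N))%:E.

Definition boyd_p : \bar R :=
  limn (fun n : nat => index_quotient n%:R (op_norm (dilate n))).

Definition boyd_q : \bar R :=
  limn (fun n : nat => index_quotient n%:R^-1 (op_norm (compress n))).

End SequenceSpace.

(* Main.v *)
Require Import Defs.
From HB Require Import structures.
From mathcomp Require Import all_boot all_order all_algebra.
From mathcomp Require Import ring.
From mathcomp Require Import all_classical all_reals all_analysis.

Set Implicit Arguments.
Unset Strict Implicit.
Unset Printing Implicit Defensive.

Import Order.TTheory GRing.Theory Num.Theory.
Import numFieldNormedType.Exports.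

Local Open Scope classical_set_scope.
Local Open Scope ring_scope.

(* Translates x_0, x_1, ... of a finitely supported vector x are disjoint, and any n of
   them add up to a rearrangement of D_n x. Hence UDS_p gives ||D_n|| <= C n^(1/p). Applied
   to D_{1/n} x instead of x, and since D_n D_{1/n} is an average of permutations and
   therefore a contraction, UDT_q gives ||D_{1/n}|| <= C^-1 n^(-1/q). Both ||D_n|| and
   n ||D_{1/n}|| are nondecreasing and submultiplicative, so the limits defining the Boyd
   indices exist. Bounds on finitely supported vectors extend to X by the Fatou property
   when X is maximal and by density when X is minimal. *)

(** * Norms of rearranged sequences *)

(* Induction on [s], correcting the image of one point by a transposition. *)
Lemma bijective_extension (s : seq nat) (sigma : nat -> nat) :
  uniq s -> {in s &, injective sigma} ->
  exists2 tau : nat -> nat, bijective tau & {in s, tau =1 sigma}.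
Proof.
elim: s => [|a s IH] /=; first by move=> _ _; exists id => //; exists id.
move=> /andP[as_ us] inj.
have [|tau btau tauE] := IH us.
  by move=> x y xs ys; apply: inj; rewrite inE ?xs ?ys orbT.
pose swap x := if x == tau a then sigma a else if x == sigma a then tau a else x.
have swapK : involutive swap.
  move=> x; rewrite /swap.
  have [->|xa] := eqVneq x (tau a).
    by rewrite eqxx; case: eqVneq => // ->.
  have [->|xs] := eqVneq x (sigma a); first by rewrite eqxx.
  by rewrite (negbTE xa) (negbTE xs).
exists (swap \o tau); first exact: bij_comp (inv_bij swapK) btau.
move=> x; rewrite inE => /predU1P[->|xs] /=; first by rewrite /swap eqxx.
have xa : x != a by apply: contraNneq as_ => <-.
rewrite /swap (inj_eq (bij_inj btau)) (negbTE xa) tauE //.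
case: eqVneq => // sxa.
by move: xa; rewrite (inj x a _ _ sxa) ?inE ?eqxx ?xs ?orbT.
Qed.

Section SequenceNorm.
Variables (R : realType) (X : completeNormedModType R).
Variable coord : {linear X -> (nat -> R^o)}.
Hypothesis X_ri : ri_space coord.

Local Notation nm := (seq_norm coord).

Definition finitely_supported (f : nat -> R) : Prop :=
  exists N : nat, forall k, (N <= k)%N -> f k = 0.

Lemma seq_norm_coord (x : X) : nm (coord x) = `|x|%:E.
Proof.
rewrite /seq_norm; have -> : [set y | coord y = coord x] = [set x].
  by apply/seteqP; split => y /= => [/(ri_inj X_ri)|->].
by rewrite image_set1 ereal_inf1.
Qed.

Lemma seq_norm_lty (f : nat -> R) :
  (nm f < +oo)%E -> exists x : X, coord x = f.
Proof.
move=> /ereal_inf_lt [_ /= [x xf _] _]; by exists x.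
Qed.

Lemma finitely_supported_coord (f : nat -> R) :
  finitely_supported f -> exists x : X, coord x = f.
Proof.
move=> [N fN].
have unit k : exists x : X, coord x = \1_[set k].
  exact/seq_norm_lty/(ri_indic X_ri)/finite_set1.
have [e eE] := choice unit.
exists (\sum_(k < N) f k *: e k); rewrite linear_sum; apply/funext => j.
rewrite fct_sumE.
under eq_bigr => k _ do rewrite linearZ /= eE.
have [jN|Nj] := ltnP j N; last first.
  rewrite fN// big1// => k _.
  rewrite fctE /= indicE memNset ?scaler0//= => jk.
  by move: (ltn_ord k); rewrite -jk ltnNge Nj.
rewrite (bigD1 (Ordinal jN))//= big1 ?addr0.
  by rewrite fctE indicE mem_set// /GRing.scale/= mulr1.
move=> k kj; rewrite fctE indicE memNset ?scaler0//= => jk.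
by move/eqP: kj; apply; apply: val_inj.
Qed.

(** Since [g] lives on finitely many points, [sigma] agrees there with a permutation [tau] of the
    index set, and [f \o tau] has the norm of [f] and dominates [g] entrywise. Injectivity is thus
    required on the support of [g] only. *)
Lemma seq_norm_rearranged (f g : nat -> R) (sigma : nat -> nat) :
  finitely_supported g ->
  (forall i j, g i != 0 -> g j != 0 -> sigma i = sigma j -> i = j) ->
  (forall k, g k != 0 -> `|g k| <= `|f (sigma k)|) ->
  (nm g <= nm f)%E.
Proof.
move=> [N gN] inj gf.
have gs k : g k != 0 -> k \in [seq i <- iota 0 N | g i != 0].
  move=> gk; rewrite mem_filter gk mem_iota add0n /=.
  by rewrite ltnNge; apply: contra gk => /gN ->.
have [||tau btau tauE] :=
    @bijective_extension [seq i <- iota 0 N | g i != 0] sigma.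
- by rewrite filter_uniq// iota_uniq.
- move=> i j; rewrite !mem_filter => /andP[gi _] /andP[gj _]; exact: inj.
rewrite -(ri_invariant X_ri f btau).
apply: (ri_ideal X_ri) => k; have [->|gk] := eqVneq (g k) 0.
  by rewrite normr0.
by rewrite /= tauE ?gf ?gs.
Qed.

(** * Extension from finitely supported vectors *)

(** The second clause makes the images of the truncations of x stabilize entrywise to [T] x. [T]
    acts on all sequences because its image is not known beforehand to lie in X. *)
Definition local_operator (T : (nat -> R) -> (nat -> R)) : Prop :=
  (forall c f g k, T (fun i => c * f i + g i) k = c * T f k + T g k) /\
  (forall k, exists m, forall f g,
     (forall i, (i < m)%N -> f i = g i) -> T f k = T g k).

Definition truncate (N : nat) (f : nat -> R) : nat -> R :=
  fun k => if (k < N)%N then f k else 0.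

Lemma truncate_supported N f : finitely_supported (truncate N f).
Proof. by exists N => k Nk; rewrite /truncate ltnNge Nk. Qed.

Lemma truncate_le N f k : `|truncate N f k| <= `|f k|.
Proof. by rewrite /truncate; case: ifP => // _; rewrite normr0. Qed.

(* Fatou property of the bidual norm: each partial sum of [\sum_k |f k * g k|] only sees
   finitely many entries, on which [f] agrees with some [F N]. *)
Lemma bidual_norm_le (f : nat -> R) (M : R) (F : nat -> nat -> R) :
  (forall k, \forall N \near \oo, F N k = f k) ->
  (forall N, (nm (F N) <= M%:E)%E) ->
  (associate (associate nm) f <= M%:E)%E.
Proof.
move=> Ff FM; apply: ge_ereal_sup => _ [g /= g1 <-].
apply: lime_le.
  by apply: is_cvg_nneseries => k _ _; rewrite lee_fin.
apply: nearW => K.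
have [N FNf] : exists N, forall k, (k < K)%N -> F N k = f k.
  elim: K => [|K [N0 _]]; first by exists 0%N.
  suff: \forall N \near \oo, forall k, (k < K.+1)%N -> F N k = f k.
    by move=> /filter_ex.
  elim: K.+1 => [|n IH]; first exact: nearW.
  near=> N => k; rewrite ltnS leq_eqVlt => /predU1P[->|kn].
    by near: N; exact: Ff.
  by move: k kn; near: N.
have [x xF] : exists x : X, coord x = F N.
  by apply/seq_norm_lty/(le_lt_trans (FM N)); rewrite ltry.
apply: le_trans (FM N).
rewrite -xF seq_norm_coord -(ri_norming X_ri) xF.
apply: (@le_trans _ _ (\sum_(0 <= k <oo) `|g k * F N k|%:E)%E); last first.
  by apply: ereal_sup_ubound; exists g.
apply: le_trans (nneseries_lim_ge K _); last by move=> k _ _; rewrite lee_fin.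
rewrite big_nat [leRHS]big_nat; apply: lee_sum => k /andP[_ kK].
by rewrite FNf.
Unshelve. all: by end_near. Qed.

(** The truncations of [x] bound the bidual norm of [T (coord x)] in both cases. This is the norm of
    X as soon as the sequence lies in X, so the case distinction only concerns membership. *)
Lemma local_operator_bounded (T : (nat -> R) -> (nat -> R)) (M : R) :
  local_operator T -> 0 <= M ->
  (forall x : X, finitely_supported (coord x) ->
     (nm (T (coord x)) <= (M * `|x|)%:E)%E) ->
  forall x : X, (nm (T (coord x)) <= (M * `|x|)%:E)%E.
Proof.
move=> [Tlin Tloc] M0 TM x.
have [t tE] := choice (fun N => finitely_supported_coord
                                  (truncate_supported N (coord x))).
have tx N : `|t N| <= `|x|.
  rewrite -lee_fin -!seq_norm_coord tE.
  by apply: (ri_ideal X_ri) => k; exact: truncate_le.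
have Tt N : (nm (T (coord (t N))) <= (M * `|t N|)%:E)%E.
  by apply: TM; rewrite tE; exact: truncate_supported.
have Tcvg k : \forall N \near \oo, T (coord (t N)) k = T (coord x) k.
  have [m mP] := Tloc k; exists m => // N /= mN; apply: mP => i im.
  by rewrite tE /truncate (leq_trans im mN).
have TxM : (associate (associate nm) (T (coord x)) <= (M * `|x|)%:E)%E.
  apply: (bidual_norm_le Tcvg) => N; apply: (le_trans (Tt N)).
  by rewrite lee_fin ler_wpM2l.
suff [y yE] : exists y : X, coord y = T (coord x).
  by rewrite -yE seq_norm_coord -(ri_norming X_ri) yE.
(* In the minimal case the truncations [t N] converge to [x], so that the images
   [T (t N)] form a Cauchy sequence whose limit must be [T x]. *)
have [Xmax|Xmin] := ri_max_or_min X_ri.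
  by apply: Xmax; apply: le_lt_trans TxM _; rewrite ltry.
have TtX N : exists y : X, coord y = T (coord (t N)).
  by apply/seq_norm_lty/(le_lt_trans (Tt N)); rewrite ltry.
have [y yE] := choice TtX.
have tdist m n : (m <= n)%N -> `|t n - t m| <= `|x - t m|.
  move=> mn; rewrite -lee_fin -!seq_norm_coord !linearB !tE.
  apply: (ri_ideal X_ri) => k.
  rewrite !fctE /truncate; have [km|mk] := ltnP k m.
    by rewrite (leq_trans km mn).
  by case: ifP => // _; rewrite subr0 subr0 normr0.
(* By density some finitely supported z is within e of [x]. If z vanishes from index m on, then
   [x - t m] is entrywise at most [x - z] in absolute value. *)
have tcvg e : 0 < e -> exists m, `|x - t m| < e.
  move=> e0.
  have [z [xz zfin]] : ball x e `&`
      [set z : X | finite_set [set k | coord z k != 0]] !=set0.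
    by apply: Xmin; [exists x; exact: ballxx | exact: ball_open].
  have /finite_seqP[s sE] := zfin.
  pose m := (\max_(i <- s) i).+1; exists m.
  have zm k : (m <= k)%N -> coord z k = 0.
    move=> mk; apply/eqP; apply: contraTT mk => zk.
    have : [set` s] k by rewrite -sE.
    by rewrite /= -ltnNge /m ltnS => ks; exact: leq_bigmax_seq.
  move: xz; rewrite -ball_normE /=; apply: le_lt_trans.
  rewrite -lee_fin -!seq_norm_coord !linearB tE.
  apply: (ri_ideal X_ri) => k.
  rewrite !fctE /truncate; have [km|mk] := ltnP k m.
    by rewrite /= subrr normr0.
  by rewrite zm.
have ycauchy : cauchy (y @ \oo).
  apply: cauchy_exP => e e0.
  (* The denominator is [M + 1] because [M] may be 0. *)
  have [m xm] : exists m, `|x - t m| < e / (M + 1).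
    by apply: tcvg; rewrite divr_gt0// ltr_wpDl.
  exists (y m); exists m => // n /= mn.
  rewrite -ball_normE /= distrC.
  apply: (@le_lt_trans _ _ (M * `|t n - t m|)).
    rewrite -lee_fin -seq_norm_coord linearB !yE.
    have -> : T (coord (t n)) - T (coord (t m)) = T (coord (t n - t m)).
      apply/funext => k; rewrite fctE linearB.
      rewrite -[in RHS](opprK (coord (t m))).
      have -> : coord (t n) - - - coord (t m) =
          (fun i => (-1) * coord (t m) i + coord (t n) i).
        by apply/funext => i; rewrite !fctE opprK mulN1r addrC.
      by rewrite Tlin mulN1r addrC.
    apply: TM; exists n => k nk.
    by rewrite linearB !fctE !tE /truncate !ltnNge nk (leq_trans mn nk)/= subrr.
  apply: (@le_lt_trans _ _ (M * `|x - t m|)).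
    by rewrite ler_wpM2l// tdist.
  move: xm; rewrite ltr_pdivlMr ?ltr_wpDl// mulrC mulrDl mul1r.
  by apply: le_lt_trans; rewrite lerDl.
have /cvg_ex[l yl] : cvg (y @ \oo) by exact: cauchy_cvg.
(* Entries are norm continuous by the inclusion of X in l_oo, and the k-th entry of [y N] is
   eventually that of [T (coord x)]. *)
exists l; apply/funext => k; apply/eqP.
rewrite -subr_eq0 -normr_eq0 eq_le normr_ge0 andbT.
apply/ler_addgt0Pl => e e0; rewrite addr0.
near \oo => N.
have <- : T (coord (t N)) k = T (coord x) k by near: N; exact: Tcvg.
rewrite -yE; apply: (@le_trans _ _ `|l - y N|).
  by have := ri_linfty X_ri (l - y N) k; rewrite linearB.
apply: ltW; near: N; by move/cvgrPdist_lt : yl; exact.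
Unshelve. all: by end_near. Qed.

(** * Disjoint copies *)

(** The bound also says that [T] maps X into itself, since [seq_norm] is infinite off X. *)
Definition op_bound (T : (nat -> R) -> (nat -> R)) (M : R) : Prop :=
  forall x : X, (nm (T (coord x)) <= (M * `|x|)%:E)%E.

Lemma dilate_local n : (0 < n)%N -> local_operator (@dilate R n).
Proof.
move=> n0; split=> // k; exists (k %/ n).+1 => f g fg.
by rewrite /dilate fg.
Qed.

Lemma compress_local n : local_operator (@compress R n).
Proof.
split=> [c f g k|k].
  rewrite /compress big_split/= -mulr_sumr mulrDr; congr (_ + _).
  by rewrite mulrCA.
exists (k * n + n)%N => f g fg; rewrite /compress; congr (_ * _).
by apply: eq_bigr => i _; rewrite fg// ltn_add2l.
Qed.

Lemma finitely_supported_dilate n f : (0 < n)%N ->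
  finitely_supported f -> finitely_supported (dilate n f).
Proof.
by move=> n0 [N fN]; exists (N * n)%N => k Nk; rewrite /dilate fN// leq_divRL.
Qed.

Lemma finitely_supported_compress n f : (0 < n)%N ->
  finitely_supported f -> finitely_supported (compress n f).
Proof.
move=> n0 [N fN]; exists N => k Nk; rewrite /compress big1 ?mulr0// => i _.
by rewrite fN// (leq_trans Nk)// (leq_trans _ (leq_addr _ _))// leq_pmulr.
Qed.

Lemma sum_selected (phi : nat -> nat) (n a : nat) (c : R) : injective phi ->
  \sum_(k < n) (if a == phi k then c else 0) =
  if a \in [seq phi k | k <- iota 0 n] then c else 0.
Proof.
move=> inj; case: ifPn => [/mapP[k]|an].
  rewrite mem_iota add0n => kn ->.
  rewrite (bigD1 (Ordinal kn))//= eqxx big1 ?addr0// => i ik.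
  rewrite ifF//; apply: contraNF ik => /eqP/inj ki.
  by apply/eqP/val_inj.
rewrite big1// => k _; case: ifPn => // /eqP ak; move: an; rewrite ak map_f//.
by rewrite mem_iota add0n ltn_ord.
Qed.

Lemma coord_scaled_sum (c : R) (n : nat) (y : 'I_n -> X) i :
  coord (c *: \sum_(k < n) y k) i = c * \sum_(k < n) coord (y k) i.
Proof.
rewrite linearZ linear_sum -[LHS]/(c * (\sum_(k < n) coord (y k)) i).
by rewrite fct_sumE.
Qed.

(** The copies are x/|x| moved to consecutive blocks of length N. Any n of them repeat each nonzero
    entry n times, so up to scaling their sum rearranges D_n x. As [phi] is arbitrary, this survives
    the passage to a subsequence. *)
Lemma disjoint_copies (x : X) : finitely_supported (coord x) -> x != 0 ->
  exists2 xs : nat -> X, normalized_disjoint coord xs &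
    forall phi : nat -> nat, injective phi -> forall n, (0 < n)%N ->
      nm (dilate n (coord x)) = (`|x| * `|\sum_(k < n) xs (phi k)|)%:E.
Proof.
move=> [N0 fN0] x0.
have [N N_gt0 fN] : exists2 N, (0 < N)%N & forall k, (N <= k)%N -> coord x k = 0.
  by exists N0.+1 => // k /ltnW; exact: fN0.
pose f := coord x.
have f_lt k : f k != 0 -> (k < N)%N.
  by move=> fk; rewrite ltnNge; apply: contra fk => /fN fk0; rewrite /f fk0.
have nx0 : `|x| != 0 by rewrite normr_eq0.
pose copy j : nat -> R :=
  fun i => if (i %/ N)%N == j then `|x|^-1 * f (i %% N)%N else 0.
have copy_fin j : finitely_supported (copy j).
  exists (j.+1 * N)%N => k; rewrite -leq_divRL// /copy => jk.
  by rewrite ifF//; apply/negbTE; rewrite gtn_eqF.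
have [xs xsE] := choice (fun j => finitely_supported_coord (copy_fin j)).
have scaled_sumE n (phi : nat -> nat) : injective phi ->
    coord (`|x| *: \sum_(k < n) xs (phi k)) =
    (fun i => if (i %/ N)%N \in [seq phi k | k <- iota 0 n]
              then f (i %% N)%N else 0).
  move=> inj; apply/funext => i.
  rewrite coord_scaled_sum.
  under eq_bigr => k _ do rewrite xsE /copy.
  rewrite sum_selected//.
  by case: ifP => _; rewrite ?mulr0// mulrA divff// mul1r.
have key n (phi : nat -> nat) : injective phi -> (0 < n)%N ->
    nm (dilate n f) = (`|x| * `|\sum_(k < n) xs (phi k)|)%:E.
  move=> inj n0.
  rewrite -[X in X * _]normr_id -normrZ -seq_norm_coord scaled_sumE//.
  set S := (X in _ = nm X).
  apply/eqP; rewrite eq_le; apply/andP; split.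
    (* Position m of D_n f holds repetition m mod n of entry m / n; it goes to that entry in block
       [phi (m %% n)]. *)
    apply: (@seq_norm_rearranged _ _ (fun m => (phi (m %% n) * N + m %/ n)%N)).
    - by apply: finitely_supported_dilate => //; exists N.
    - move=> i j /f_lt iN /f_lt jN ij.
      have dij : (i %/ n = j %/ n)%N.
        by have := congr1 (modn^~ N) ij; rewrite /= !modnMDl !modn_small.
      move: ij; rewrite dij => /addIn/eqP; rewrite eqn_pmul2r// => /eqP/inj mij.
      by rewrite (divn_eq i n) (divn_eq j n) dij mij.
    move=> k /f_lt kN.
    rewrite /S divnMDl// modnMDl (modn_small kN) (divn_small kN) addn0 map_f//.
    by rewrite mem_iota add0n ltn_mod.
  have Sn0 i : S i != 0 -> (i %/ N)%N \in [seq phi k | k <- iota 0 n].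
    by rewrite /S; case: ifP => // _; rewrite eqxx.
  (* The inverse map: [index] recovers the number of the repetition from the block. *)
  apply: (@seq_norm_rearranged _ _ (fun i =>
    ((i %% N) * n + index (i %/ N) [seq phi k | k <- iota 0 n])%N)).
  - exists ((\max_(k < n) phi k).+1 * N)%N => i; rewrite -leq_divRL// /S => iN.
    case: ifPn => // /mapP[k]; rewrite mem_iota add0n => kn ik.
    by move: iN; rewrite ik ltnNge (leq_bigmax (Ordinal kn)).
  - move=> i j /Sn0 iS /Sn0 jS ij.
    have ltS k : (k %/ N)%N \in [seq phi k | k <- iota 0 n] ->
        (index (k %/ N) [seq phi k | k <- iota 0 n] < n)%N.
      by rewrite -index_mem size_map size_iota.
    have dij : (i %/ N = j %/ N)%N.
      have := congr1 (modn^~ n) ij; rewrite /= !modnMDl !modn_small ?ltS//.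
      move=> /(congr1 (nth 0%N [seq phi k | k <- iota 0 n])).
      by rewrite !nth_index.
    move: ij; rewrite dij => /addIn/eqP; rewrite eqn_pmul2r// => /eqP mij.
    by rewrite (divn_eq i N) (divn_eq j N) dij mij.
  move=> i /Sn0 iS; rewrite /S iS /dilate divnMDl// divn_small ?addn0//.
  by move: iS; rewrite -index_mem size_map size_iota.
exists xs; last by move=> phi inj n n0; exact: key.
have injxs j : injective (fun k : nat => (k + j)%N) by exact: addIn.
split=> [j|i j ij k]; last first.
  rewrite !xsE /copy; case: eqP => [->|_]; last first.
    by rewrite normr0 min_l.
  by rewrite ifF ?normr0 ?min_r//; apply/eqP.
(* The case n = 1 of [key], with the single copy number j, shows that each copy has norm one. *)
have := key 1%N _ (injxs j) isT; rewrite big_ord1.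
have -> : dilate 1 f = f by apply/funext => k; rewrite /dilate divn1.
by rewrite seq_norm_coord => -[]; rewrite add0n => xE; apply: (mulfI nx0); rewrite mulr1 -xE.
Qed.

(** * Operator bounds from upper and lower estimates *)

Lemma coord0 i : coord (0 : X) i = 0.
Proof. by rewrite linear0. Qed.

Lemma coordZ (c : R) (x : X) i : coord (c *: x) i = c * coord x i.
Proof. by rewrite linearZ. Qed.

Lemma local_operator_coord T (c : R) (x : X) : local_operator T ->
  T (coord (c *: x)) = (fun k => c * T (coord x) k).
Proof.
move=> [Tlin _]; apply/funext => k.
have T0 : T (coord 0) k = 0.
  have := Tlin 1 (coord 0) (coord 0) k.
  have -> : (fun i => 1 * coord 0 i + coord 0 i) = coord (0 : X).
    by apply/funext => i; rewrite !coord0 mulr0 addr0.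
  by move/eqP; rewrite mul1r -subr_eq0 opprD addNKr oppr_eq0 => /eqP.
rewrite -[RHS]addr0 -T0 -Tlin; congr (T _ k).
by apply/funext => i; rewrite coordZ coord0 addr0.
Qed.

(** The zero vector is set aside since [disjoint_copies] has to normalize. *)
Lemma op_bound_supported T M : local_operator T -> 0 <= M ->
  (forall x : X, finitely_supported (coord x) -> x != 0 ->
     (nm (T (coord x)) <= (M * `|x|)%:E)%E) ->
  op_bound T M.
Proof.
move=> Tloc M0 TM; apply: local_operator_bounded => // x xfin.
have [->|x0] := eqVneq x 0; last exact: TM.
rewrite -[in coord _](scale0r (0 : X)) local_operator_coord//.
have -> : (fun k => 0 * T (coord 0) k) = coord (0 : X).
  by apply/funext => k; rewrite mul0r coord0.
by rewrite seq_norm_coord normr0 mulr0.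
Qed.

Lemma sum_norm1_powR (p : R) n : \sum_(k < n) `|1 : R| `^ p = n%:R.
Proof.
under eq_bigr do rewrite normr1 powR1.
by rewrite sumr_const card_ord.
Qed.

Lemma increasing_seq_inj (phi : nat -> nat) : increasing_seq phi -> injective phi.
Proof.
by move=> inc i j ij; apply/eqP; rewrite eqn_leq -!inc ij lexx.
Qed.

(** The estimate is used with all coefficients 1. One constant [C] serves every n and every x
    because it does not depend on the disjoint sequence. *)
Lemma UDS_dilate (p : R) : UDS coord p -> exists2 C : R, 0 < C &
  forall n, (0 < n)%N -> op_bound (@dilate R n) (C * n%:R `^ p^-1).
Proof.
move=> [C C0 uds]; exists C => // n n0.
apply: op_bound_supported; first exact: dilate_local.
  by rewrite mulr_ge0 ?powR_ge0// ltW.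
move=> x xfin x0; have [xs xs_disj xsE] := disjoint_copies xfin x0.
have [phi phi_inc /(_ n (fun=> 1))] := uds _ xs_disj.
rewrite sum_norm1_powR; under eq_bigr do rewrite scale1r.
rewrite (xsE _ (increasing_seq_inj phi_inc))// lee_fin => le_C.
by rewrite mulrC ler_wpM2r.
Qed.

(** D_n D_{1/n} replaces each block of n entries by its mean, which is the average of the n cyclic
    rotations inside the blocks. *)
Lemma seq_norm_dilate_compress n (x : X) :
  (0 < n)%N -> finitely_supported (coord x) ->
  (nm (dilate n (compress n (coord x))) <= `|x|%:E)%E.
Proof.
move=> n0 [N fN].
pose rot (i m : nat) := (m %/ n * n + (m %% n + i) %% n)%N.
have rot_div i m : (rot i m %/ n = m %/ n)%N.
  by rewrite divnMDl// (divn_small (ltn_pmod _ n0)) addn0.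
have rot_fin i : finitely_supported (coord x \o rot i).
  exists (N * n)%N => m; rewrite -leq_divRL// => Nm.
  rewrite /= fN// (leq_trans Nm)// -(rot_div i m); exact: leq_div.
have [y yE] := choice (fun i => finitely_supported_coord (rot_fin i)).
have y_le i : `|y i| <= `|x|.
  rewrite -lee_fin -!seq_norm_coord yE.
  apply: (@seq_norm_rearranged _ _ (rot i)) => //.
  move=> a b _ _ ab.
  have dab : (a %/ n = b %/ n)%N by rewrite -(rot_div i a) ab rot_div.
  move: ab; rewrite /rot dab => /addnI /eqP; rewrite eqn_modDr !modn_mod => /eqP mab.
  by rewrite (divn_eq a n) (divn_eq b n) dab mab.
have -> : dilate n (compress n (coord x)) = coord (n%:R^-1 *: \sum_(i < n) y i).
  apply/funext => m; rewrite coord_scaled_sum.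
  rewrite /dilate /compress; congr (_ * _).
  (* At position m, rotation by i reads entry [shift i] of the block containing m; reindexing by
     [shift] gives the block sum. *)
  pose shift (i : 'I_n) : 'I_n := Ordinal (ltn_pmod (m %% n + i) n0).
  have shift_inj : injective shift.
    move=> i j /(congr1 val) /= /eqP; rewrite eqn_modDl !modn_small// => /eqP.
    exact: val_inj.
  by rewrite (reindex_inj shift_inj); apply: eq_bigr => i _; rewrite yE.
rewrite seq_norm_coord lee_fin normrZ ger0_norm ?invr_ge0//.
rewrite ler_pdivrMl ?ltr0n// (le_trans (ler_norm_sum _ _ _))//.
rewrite mulr_natl -[n in leRHS]card_ord -sumr_const.
exact: ler_sum.
Qed.

(** With y = D_{1/n} x, the copies of y give C n^(1/q) |y| <= ||D_n y|| <= |x|. *)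
Lemma UDT_compress (q : R) : UDT coord q -> exists2 C : R, 0 < C &
  forall n, (0 < n)%N -> op_bound (@compress R n) (C * n%:R `^ (- q^-1)).
Proof.
move=> [C C0 udt]; exists C^-1; first by rewrite invr_gt0.
move=> n n0; apply: op_bound_supported; first exact: compress_local.
  by rewrite mulr_ge0 ?powR_ge0// invr_ge0 ltW.
move=> x xfin _.
have yfin := finitely_supported_compress n0 xfin.
have [y yE] := finitely_supported_coord yfin.
rewrite -yE seq_norm_coord lee_fin.
(* Cancellation inside the blocks can make y vanish although x does not. *)
have [->|y0] := eqVneq y 0.
  by rewrite normr0 !mulr_ge0 ?powR_ge0// invr_ge0 ltW.
rewrite -yE in yfin.
have [ys ys_disj ysE] := disjoint_copies yfin y0.
have [phi phi_inc /(_ n (fun=> 1))] := udt _ ys_disj.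
rewrite sum_norm1_powR; under [in leRHS]eq_bigr do rewrite scale1r.
have := seq_norm_dilate_compress n0 xfin.
rewrite -yE (ysE _ (increasing_seq_inj phi_inc))// lee_fin => le_x le_y.
have Cn0 : 0 < C * n%:R `^ q^-1 by rewrite mulr_gt0 ?powR_gt0 ?ltr0n.
rewrite powRN -invfM mulrC ler_pdivlMr//.
by apply: le_trans le_x; rewrite ler_wpM2l.
Qed.

(** * Operator norms of dilations and compressions *)

Definition op_norm_val T : R := fine (op_norm coord T).

Lemma op_norm_ge0 T : (0 <= op_norm coord T)%E.
Proof.
apply: (@le_trans _ _ (nm (T (coord 0)))).
  by apply: le_ereal_inf_tmp => _ [x _ <-]; rewrite lee_fin.
by apply: ereal_sup_ubound; exists 0 => //=; rewrite normr0.
Qed.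

Lemma op_norm_val_ge0 T : 0 <= op_norm_val T.
Proof. exact/fine_ge0/op_norm_ge0. Qed.

Lemma op_norm_le T M : op_bound T M -> 0 <= M -> (op_norm coord T <= M%:E)%E.
Proof.
move=> TM M0; apply: ge_ereal_sup => _ [x /= x1 <-]; apply: (le_trans (TM x)).
by rewrite lee_fin ler_piMr.
Qed.

Lemma op_norm_fin T M : op_bound T M -> 0 <= M ->
  op_norm coord T = (op_norm_val T)%:E.
Proof.
move=> TM M0; rewrite /op_norm_val fineK// ge0_fin_numE ?op_norm_ge0//.
by apply: le_lt_trans (op_norm_le TM M0) _; rewrite ltry.
Qed.

Lemma op_norm_val_le T M : op_bound T M -> 0 <= M -> op_norm_val T <= M.
Proof.
move=> TM M0; by rewrite -lee_fin -(op_norm_fin TM M0) op_norm_le.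
Qed.

(** The preliminary bound [M] puts [T] x in X and makes the supremum finite; homogeneity then
    reduces to the unit ball. *)
Lemma op_bound_op_norm_val T M : local_operator T -> op_bound T M -> 0 <= M ->
  op_bound T (op_norm_val T).
Proof.
move=> Tloc TM M0.
have T_lin (c : R) (x y : X) : coord y = T (coord x) ->
    coord (c *: y) = T (coord (c *: x)).
  move=> yx; rewrite local_operator_coord//; apply/funext => k.
  by rewrite coordZ yx.
move=> x; have [y yE] : exists y : X, coord y = T (coord x).
  by apply/seq_norm_lty/(le_lt_trans (TM x)); rewrite ltry.
rewrite -yE seq_norm_coord lee_fin.
have [x0|x0] := eqVneq x 0.
  have := TM x; rewrite -yE seq_norm_coord lee_fin x0 normr0 !mulr0.
  exact.
rewrite -ler_pdivrMr ?normr_gt0// mulrC.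
have -> : `|x|^-1 * `|y| = `| `|x|^-1 *: y| by rewrite normrZ normfV normr_id.
rewrite -lee_fin -(op_norm_fin TM M0) -seq_norm_coord (T_lin _ _ _ yE).
apply: ereal_sup_ubound; exists (`|x|^-1 *: x) => //=.
by rewrite normrZ normfV normr_id mulVf// normr_eq0.
Qed.

Lemma op_bound_comp S T A B : op_bound S A -> op_bound T B -> 0 <= A ->
  op_bound (S \o T) (A * B).
Proof.
move=> SA TB A0 x; have [y yE] : exists y : X, coord y = T (coord x).
  by apply/seq_norm_lty/(le_lt_trans (TB x)); rewrite ltry.
rewrite /= -yE (le_trans (SA y))// lee_fin -mulrA ler_wpM2l//.
by rewrite -lee_fin -seq_norm_coord yE.
Qed.

(** The inclusions of l_1 in X and of X in l_oo have norm one, which bounds |e| from above and from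
    below. *)
Lemma unit_vector : exists2 e : X, `|e| = 1 & coord e = \1_[set 0%N].
Proof.
have [e eE] : exists e : X, coord e = \1_[set 0%N].
  exact/seq_norm_lty/(ri_indic X_ri)/finite_set1.
exists e => //; apply/eqP; rewrite eq_le; apply/andP; split.
  rewrite -lee_fin -seq_norm_coord (le_trans (ri_l1 X_ri _))//.
  rewrite (nneseries_split 0 1)//= add0n big_nat1 eE indicE mem_set// normr1 eseries0 ?adde0// => k k0 _.
  by rewrite indicE memNset ?normr0// => k0'; rewrite k0' in k0.
by have := ri_linfty X_ri e 0%N; rewrite eE indicE mem_set// normr1.
Qed.

Section Dilations.
Variable M : nat -> R.
Hypothesis M_ge0 : forall n, 0 <= M n.
Hypothesis dilate_bound : forall n, (0 < n)%N -> op_bound (@dilate R n) (M n).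

Let d n := op_norm_val (@dilate R n).

Let dP n : (0 < n)%N -> op_bound (@dilate R n) (d n).
Proof.
move=> n0; exact: (op_bound_op_norm_val (dilate_local n0) (dilate_bound n0)).
Qed.

(** D_n e_0 dominates e_0. *)
Lemma dilate_norm_ge1 n : (0 < n)%N -> 1 <= d n.
Proof.
move=> n0; have [e e1 eE] := unit_vector.
have := dP n0 e; rewrite e1 mulr1; rewrite -lee_fin; apply: le_trans.
rewrite -e1 -seq_norm_coord; apply: (ri_ideal X_ri) => k.
rewrite /dilate eE !indicE; have [->|k0] := eqVneq k 0%N; first by rewrite div0n.
by rewrite [in leLHS]memNset ?normr0//= => /eqP; rewrite (negbTE k0).
Qed.

(** Keeping the first m of the n repetitions of each entry of D_n x leaves a rearrangement of D_m
    x. *)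
Lemma dilate_norm_mono m n : (0 < m <= n)%N -> d m <= d n.
Proof.
move=> /andP[m0 mn]; have n0 := leq_trans m0 mn.
apply: op_norm_val_le; last exact: op_norm_val_ge0.
apply: op_bound_supported; [exact: dilate_local | exact: op_norm_val_ge0 |].
move=> x xfin _; apply: le_trans (dP n0 x).
apply: (@seq_norm_rearranged _ _ (fun k => (k %/ m * n + k %% m)%N)).
- exact: finitely_supported_dilate.
- move=> i j _ _ ij.
  have lt k : (k %% m < n)%N by rewrite (leq_trans _ mn)// ltn_mod.
  have mij : (i %% m = j %% m)%N.
    by have := congr1 (modn^~ n) ij; rewrite /= !modnMDl !(modn_small (lt _)).
  move: ij; rewrite mij => /addIn/eqP; rewrite eqn_pmul2r// => /eqP dij.
  by rewrite (divn_eq i m) (divn_eq j m) dij mij.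
move=> k _; rewrite /dilate divnMDl// (@divn_small (k %% m)) ?addn0//.
by rewrite (leq_trans _ mn)// ltn_mod.
Qed.

Lemma dilate_norm_mul m n : (0 < m)%N -> (0 < n)%N -> d (m * n)%N <= d m * d n.
Proof.
move=> m0 n0; apply: op_norm_val_le; last by rewrite mulr_ge0 ?op_norm_val_ge0.
have -> : @dilate R (m * n) = @dilate R m \o @dilate R n.
  by apply/funext => f; apply/funext => k; rewrite /= /dilate divnMA.
by apply: op_bound_comp; [exact: dP | exact: dP | exact: op_norm_val_ge0].
Qed.

End Dilations.

Section Compressions.
Variable M : nat -> R.
Hypothesis M_ge0 : forall n, 0 <= M n.
Hypothesis compress_bound :
  forall n, (0 < n)%N -> op_bound (@compress R n) (M n).

(** This is the norm of the operator that sums over blocks of length n without averaging. *)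
Let d n := n%:R * op_norm_val (@compress R n).

Let dP n : (0 < n)%N -> op_bound (@compress R n) (op_norm_val (@compress R n)).
Proof.
move=> n0; exact: (op_bound_op_norm_val (compress_local n) (compress_bound n0)).
Qed.

(** D_{1/n} e_0 = e_0 / n. *)
Lemma compress_norm_ge1 n : (0 < n)%N -> 1 <= d n.
Proof.
move=> n0; have [e e1 eE] := unit_vector.
have n_gt0 : 0 < n%:R :> R by rewrite ltr0n.
rewrite /d -ler_pdivrMl// mulr1.
have := dP n0 e; rewrite e1 mulr1; rewrite -lee_fin; apply: le_trans.
have -> : n%:R^-1 = `|n%:R^-1 *: e|.
  by rewrite normrZ e1 mulr1 gtr0_norm ?invr_gt0.
rewrite -seq_norm_coord; apply: (ri_ideal X_ri) => k.
rewrite coordZ /compress eE !normrM ler_wpM2l//.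
have [->|k0] := eqVneq k 0%N; last first.
  by rewrite indicE [in leLHS]memNset ?normr0//= => /eqP; rewrite (negbTE k0).
rewrite (bigD1 (Ordinal n0))//= big1 ?addr0// => i i0.
by rewrite indicE memNset//= => /eqP; rewrite mul0n add0n; apply/negP.
Qed.

(* [n * compress n] sums over blocks of length [n]; padding blocks of length [m] with zeros
   turns them into blocks of length [n]. *)
Lemma compress_norm_mono m n : (0 < m <= n)%N -> d m <= d n.
Proof.
move=> /andP[m0 mn]; have n0 := leq_trans m0 mn.
have m_gt0 : 0 < m%:R :> R by rewrite ltr0n.
have n_gt0 : 0 < n%:R :> R by rewrite ltr0n.
rewrite /d -ler_pdivlMl// mulrA.
have c_ge0 : 0 <= m%:R^-1 * n%:R * op_norm_val (@compress R n).
  by rewrite !mulr_ge0 ?op_norm_val_ge0 ?invr_ge0// ltW.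
apply: op_norm_val_le => //.
apply: op_bound_supported => //; first exact: compress_local.
move=> x [N xN] _.
pose g : nat -> R :=
  fun j => if (j %% n < m)%N then coord x (j %/ n * m + j %% n)%N else 0.
have gn0 j : g j != 0 -> (j %% n < m)%N.
  by rewrite /g; case: ifP => // _; rewrite eqxx.
have gfin : finitely_supported g.
  exists (N * n)%N => j; rewrite -leq_divRL// /g => Nj; case: ifP => // _.
  by rewrite xN// (leq_trans Nj)// (leq_trans _ (leq_addr _ _))// leq_pmulr.
have [y yE] := finitely_supported_coord gfin.
have yx : `|y| <= `|x|.
  rewrite -lee_fin -!seq_norm_coord yE.
  apply: (@seq_norm_rearranged _ _ (fun j => (j %/ n * m + j %% n)%N)) => //.
  - move=> i j /gn0 im /gn0 jm ij.
    have mij : (i %% n = j %% n)%N.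
      have := congr1 (modn^~ m) ij.
      by rewrite /= !modnMDl (modn_small im) (modn_small jm).
    move: ij; rewrite mij => /addIn/eqP; rewrite eqn_pmul2r// => /eqP dij.
    by rewrite (divn_eq i n) (divn_eq j n) dij mij.
  - by move=> j gj; rewrite /g gn0.
have [z zE] : exists z : X, coord z = compress n (coord y).
  by apply/seq_norm_lty/(le_lt_trans (dP n0 y)); rewrite ltry.
(* Padding keeps the block sums, and the factor n/m corrects the averaging. *)
have -> : compress m (coord x) = coord ((m%:R^-1 * n%:R) *: z).
  apply/funext => k; rewrite coordZ zE yE /compress mulrA.
  rewrite mulfK ?gt_eqF//; congr (_ * _).
  rewrite -(big_mkord xpredT (fun i => coord x (k * m + i)%N)).
  rewrite -(big_mkord xpredT (fun i => g (k * n + i)%N)).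
  rewrite (big_cat_nat _ mn)//= [X in _ + X]big_nat [X in _ + X]big1 ?addr0.
    apply: eq_big_nat => i /andP[_ im].
    have iN := leq_trans im mn.
    by rewrite /g modnMDl divnMDl// (modn_small iN) (divn_small iN) addn0 im.
  move=> i /andP[mi iN].
  by rewrite /g modnMDl (modn_small iN) ltnNge mi.
rewrite seq_norm_coord lee_fin normrZ ger0_norm; last first.
  by rewrite mulr_ge0 ?invr_ge0// ltW.
rewrite -[leRHS]mulrA ler_wpM2l ?mulr_ge0 ?invr_ge0 ?(ltW m_gt0) ?(ltW n_gt0)//.
have := dP n0 y; rewrite -zE seq_norm_coord lee_fin => /le_trans; apply.
by rewrite ler_wpM2l// op_norm_val_ge0.
Qed.

Lemma compress_norm_mul m n : (0 < m)%N -> (0 < n)%N -> d (m * n)%N <= d m * d n.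
Proof.
move=> m0 n0; rewrite /d natrM mulrACA ler_wpM2l//.
apply: op_norm_val_le; last by rewrite mulr_ge0 ?op_norm_val_ge0.
have -> : @compress R (m * n) = @compress R m \o @compress R n.
  apply/funext => f; apply/funext => k; rewrite /= /compress.
  rewrite natrM invfM -mulrA; congr (_ * _); rewrite -mulr_sumr; congr (_ * _).
  (* A block of length m n is cut into m blocks of length n. *)
  rewrite -(big_mkord xpredT (fun i => f (k * (m * n) + i)%N)) big_nat_mul.
  rewrite big_mkord; apply: eq_bigr => i _.
  rewrite -{1}[(i * n)%N]add0n big_addn mulSn addnK big_mkord.
  by apply: eq_bigr => j _; congr f; rewrite mulnDl mulnA -addnA (addnC j).
by apply: op_bound_comp; [exact: dP | exact: dP | exact: op_norm_val_ge0].
Qed.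

End Compressions.
End SequenceNorm.

(** * Limits *)

Section Limits.
Variable R : realType.

Lemma near_ln_gt (A : R) : \forall n \near \oo, A < ln n%:R.
Proof.
have := nbhs_infty_gtr (expR A); apply: filterS => n An.
by rewrite -ltr_expR lnK// posrE (lt_trans _ An)// expR_gt0.
Qed.

Lemma log_ratio_cvg (d : nat -> R) (C s : R) :
  (forall n, (0 < n)%N -> 1 <= d n) ->
  (forall m n, (0 < m <= n)%N -> d m <= d n) ->
  (forall m n, (0 < m)%N -> (0 < n)%N -> d (m * n)%N <= d m * d n) ->
  (forall n, (0 < n)%N -> d n <= C * n%:R `^ s) -> 0 < C ->
  exists2 L, 0 <= L <= s & ln (d n) / ln n%:R @[n --> \oo] --> L.
Proof.
move=> d_ge1 d_mono d_mul d_le C0.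
pose v n := ln (d n) / ln n%:R.
have d_gt0 n : (0 < n)%N -> 0 < d n by move=> /d_ge1; exact: lt_le_trans.
have lnd_ge0 n : (0 < n)%N -> 0 <= ln (d n) by move=> /d_ge1/ln_ge0.
have ln_gt0 n : (1 < n)%N -> 0 < ln n%:R :> R.
  by move=> n1; rewrite ln_gt0// ltr1n.
have v_ge0 n : (1 < n)%N -> 0 <= v n.
  by move=> n1; rewrite divr_ge0 ?lnd_ge0// ?(ltW (ln_gt0 _ n1))// ltnW.
have d_exp n k : (0 < n)%N -> ln (d (n ^ k.+1)%N) <= k.+1%:R * ln (d n).
  move=> n0; elim: k => [|k IH]; first by rewrite expn1 mul1r.
  rewrite expnS -natr1 mulrDl mul1r addrC.
  apply: le_trans (lerD (lexx _) IH).
  rewrite -lnM ?posrE ?d_gt0 ?expn_gt0 ?n0//.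
  rewrite ler_ln ?posrE ?mulr_gt0 ?d_gt0 ?muln_gt0 ?expn_gt0 ?n0//.
  by rewrite d_mul// expn_gt0 n0.
(* Compare [m] with the powers [n ^ k <= m < n ^ k.+1]. *)
have v_le n m : (1 < n)%N -> (1 < m)%N -> v m <= v n + ln (d n) / ln m%:R.
  move=> n1 m1; have n0 := ltnW n1; have m0 := ltnW m1.
  have /andP[km mk] := trunc_log_bounds n1 m0.
  set k := trunc_log n m in km mk.
  have dm : ln (d m) <= k.+1%:R * ln (d n).
    apply: le_trans (d_exp n k n0); rewrite ler_ln ?posrE ?d_gt0 ?expn_gt0 ?n0//.
    by rewrite d_mono// m0 ltnW.
  have km' : k%:R * ln n%:R <= ln m%:R :> R.
    rewrite mulr_natl -lnXn ?ltr0n// -natrX ler_ln ?posrE ?ltr0n ?expn_gt0 ?n0//.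
    by rewrite ler_nat.
  rewrite /v [leRHS](_ : _ = (ln (d n) * (ln m%:R / ln n%:R + 1)) / ln m%:R).
    rewrite ler_pM2r ?invr_gt0 ?ln_gt0//; apply: le_trans dm _.
    rewrite mulrC ler_wpM2l ?lnd_ge0// -natr1 lerD2r.
    by rewrite ler_pdivlMr ?ln_gt0.
  by field; rewrite !gt_eqF ?ln_gt0.
pose V := [set v n | n in [set n | (1 < n)%N]].
have V_lb : lbound V 0 by move=> _ [n n1 <-]; exact: v_ge0.
have V_inf : has_inf V by split; [exists (v 2%N), 2%N | exists 0].
have v_cvg : v n @[n --> \oo] --> inf V.
  apply/cvgrPdist_le => e e0.
  have e20 : 0 < e / 2 by rewrite divr_gt0.
  (* Fix n with [v n] within e/2 of the infimum; for m large the error term of [v_le] is below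
     e/2. *)
  have [_ [n /= n1 <-] vn] := inf_adherent e20 V_inf.
  near=> m.
  have m1 : (1 < m)%N by near: m; exists 2%N.
  have Vm : inf V <= v m by apply: inf_lbound; [exists 0|exists m].
  rewrite distrC ger0_norm ?subr_ge0// lerBlDl.
  apply: le_trans (v_le _ _ n1 m1) _.
  rewrite [e]splitr addrA lerD ?ltW//.
  rewrite ltr_pdivrMr ?ln_gt0// -ltr_pdivrMl// mulrC.
  by near: m; exact: near_ln_gt.
exists (inf V) => //; apply/andP; split.
  by apply: lb_le_inf => //; exists (v 2%N), 2%N.
apply/ler_addgt0Pl => e e0; near \oo => n.
have n1 : (1 < n)%N by near: n; exists 2%N.
apply: (@le_trans _ _ (v n)); first by apply: inf_lbound; [exists 0|exists n].
rewrite ler_pdivrMr ?ln_gt0// mulrDl.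
apply: (@le_trans _ _ (ln C + s * ln n%:R)).
  rewrite -ln_powR -lnM ?posrE// ?powR_gt0 ?ltr0n ?(ltnW n1)//.
  rewrite ler_ln ?posrE ?mulr_gt0 ?powR_gt0 ?d_gt0 ?ltr0n ?(ltnW n1)//.
  by rewrite d_le// ltnW.
rewrite lerD2r -ler_pdivrMl// mulrC; apply: ltW; near: n.
exact: near_ln_gt.
Unshelve. all: by end_near. Qed.

(** The inverse of 0 is +oo in the extended reals, so at L = 0 the sign condition keeps the inverses
    from tending to -oo. This case is an infinite Boyd index. *)
Lemma cvg_inve (w : nat -> R) (L : R) :
  (\forall n \near \oo, 0 <= w n) -> w n @[n --> \oo] --> L ->
  ((w n)%:E^-1)%E @[n --> \oo] --> (L%:E^-1)%E.
Proof.
move=> w0 wL; rewrite inver; case: eqVneq => [L0|L0].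
  apply/cvgeyPge => A; have [A0|A0] := leP A 0.
    apply: filterS w0 => n wn0; rewrite inver; case: eqVneq => _.
      exact: leey.
    by rewrite lee_fin (le_trans A0)// invr_ge0.
  have wA : \forall n \near \oo, w n < A^-1.
    by apply: (cvgr_lt _ wL); rewrite L0 invr_gt0.
  apply: filterS2 w0 wA => n wn0 wnA; rewrite inver; case: eqVneq => [_|wn].
    exact: leey.
  have wn_gt0 : 0 < w n by rewrite lt_def wn.
  by rewrite lee_fin -[A]invrK lef_pV2 ?posrE ?invr_gt0// ltW.
apply: (@cvg_trans _ (((w n)^-1)%:E @[n --> \oo])).
  apply: near_eq_cvg; near=> n.
  by rewrite inver ifF//; apply/negbTE; near: n; exact: (cvgr_neq0 _ wL).
by apply: cvg_EFin; [exact: nearW | exact: cvgV].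
Unshelve. all: by end_near. Qed.

End Limits.

(** Because the extended inverse of 0 is +oo, the convention for norm 1 is absorbed in one
    formula. *)
Lemma index_quotientE (R : realType) (t N : R) : ln t != 0 -> 0 < N ->
  index_quotient t N%:E = ((ln N / ln t)%:E^-1)%E.
Proof.
move=> lnt0 N0; rewrite /index_quotient eqe inver mulf_eq0 invr_eq0 (negbTE lnt0).
rewrite orbF invf_div; have [->|N1] := eqVneq N 1; first by rewrite ln1 eqxx.
by rewrite ln_eq0// (negbTE N1).
Qed.

(** * Bounds on the Boyd indices *)

Theorem proposition1 (R : realType) (X : completeNormedModType R)
    (coord : {linear X -> (nat -> R^o)})
    (X_ri : ri_space coord) (X_sep : separable X)
    (p q : R) (p_gt1 : 1 < p) (q_gt1 : 1 < q) :
  (UDS coord p -> (p%:E <= boyd_p coord)%E) /\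
  (UDT coord q -> (boyd_q coord <= q%:E)%E).
Proof.
have p0 : 0 < p := lt_trans ltr01 p_gt1.
have q0 : 0 < q := lt_trans ltr01 q_gt1.
have ln_gt0 n : (1 < n)%N -> 0 < ln n%:R :> R by move=> n1; rewrite ln_gt0// ltr1n.
split.
  move=> /(UDS_dilate X_ri)[C C0 bound].
  have M0 n : 0 <= C * n%:R `^ p^-1 by rewrite mulr_ge0 ?powR_ge0// ltW.
  have ge1 := dilate_norm_ge1 X_ri M0 bound.
  (* L is the limit of ln ||D_n|| / ln n, so that p_X = 1/L and L <= 1/p. *)
  have [L /andP[L0 Lp] vL] := log_ratio_cvg ge1
    (dilate_norm_mono X_ri M0 bound) (dilate_norm_mul X_ri M0 bound)
    (fun n n0 => op_norm_val_le (bound n n0) (M0 n)) C0.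
  have quotient_cvg : index_quotient n%:R (op_norm coord (dilate n))
      @[n --> \oo] --> (L%:E^-1)%E.
    apply: cvg_trans (cvg_inve _ vL).
      apply: near_eq_cvg; near=> n.
      have n1 : (1 < n)%N by near: n; exists 2%N.
      have n0 := ltnW n1.
      rewrite (op_norm_fin (bound n n0) (M0 n)) index_quotientE//.
        by rewrite gt_eqF ?ln_gt0.
      exact: lt_le_trans (ge1 n n0).
    near=> n; have n1 : (1 < n)%N by near: n; exists 2%N.
    by rewrite divr_ge0 ?(ltW (ln_gt0 n n1))// ln_ge0// ge1// ltnW.
  rewrite /boyd_p (cvg_lim _ quotient_cvg)// inver.
  case: eqVneq => [_|Ln0]; first exact: leey.
  by rewrite lee_fin -[p]invrK lef_pV2// ?posrE ?invr_gt0// lt_def Ln0.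
move=> /(UDT_compress X_ri)[C C0 bound].
have M0 n : 0 <= C * n%:R `^ (- q^-1) by rewrite mulr_ge0 ?powR_ge0// ltW.
have ge1 := compress_norm_ge1 X_ri M0 bound.
have le_pow n : (0 < n)%N ->
    n%:R * op_norm_val coord (@compress R n) <= C * n%:R `^ (1 - q^-1).
  move=> n0; have n_gt0 : 0 < n%:R :> R by rewrite ltr0n.
  rewrite powRD; last by rewrite (gt_eqF n_gt0) implybT.
  rewrite powRr1 ?(ltW n_gt0)// mulrCA ler_pM2l//.
  exact: op_norm_val_le (bound n n0) (M0 n).
have [L /andP[L0 Lq] vL] := log_ratio_cvg ge1
  (compress_norm_mono X_ri M0 bound) (compress_norm_mul X_ri M0 bound) le_pow C0.
(* The left side equals ln ||D_{1/n}|| / ln (1/n) for n > 1, whence q_X = 1/(1 - L). *)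
have wL : 1 - ln (n%:R * op_norm_val coord (@compress R n)) / ln n%:R
    @[n --> \oo] --> 1 - L by apply: cvgB => //; exact: cvg_cst.
(* L <= 1 - 1/q < 1, so q_X is finite. *)
have L1_gt0 : 0 < 1 - L.
  by rewrite subr_gt0 (le_lt_trans Lq)// ltrBlDr ltrDl invr_gt0.
have quotient_cvg : index_quotient n%:R^-1 (op_norm coord (compress n))
    @[n --> \oo] --> ((1 - L)%:E^-1)%E.
  apply: cvg_trans (cvg_inve _ wL).
    apply: near_eq_cvg; near=> n.
    have n1 : (1 < n)%N by near: n; exists 2%N.
    have n0 := ltnW n1.
    have n_gt0 : 0 < n%:R :> R by rewrite ltr0n.
    have N_gt0 : 0 < op_norm_val coord (@compress R n).
      by rewrite -(pmulr_rgt0 _ n_gt0) (lt_le_trans ltr01)// ge1.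
    have lnn0 : ln n%:R != 0 :> R by rewrite gt_eqF ?ln_gt0.
    rewrite (op_norm_fin (bound n n0) (M0 n)) index_quotientE//; last first.
      by rewrite lnV ?posrE// oppr_eq0.
    rewrite lnM ?posrE// lnV ?posrE//; congr (_%:E^-1)%E.
    by field.
  near=> n; apply: ltW; near: n; exact: (cvgr_gt _ wL).
rewrite /boyd_q (cvg_lim _ quotient_cvg)// inver gt_eqF//.
rewrite lee_fin -[q]invrK lef_pV2 ?posrE ?invr_gt0//.
by rewrite lerBrDl -lerBrDr.
Unshelve. all: by end_near. Qed.
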